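(* Let $m,k,n\in\mathbb{N}$, $N\in\mathbb{Z}_{\ge0}$, let $P\subseteq\mathbb{Z}^m$, and let $\mathcal{E}_i,\mathcal{D}_i:\mathcal{I}_P\to\mathcal{I}_P$, $i\in\{0,1,\dots,n\}$, be two sequences of operations satisfying (A1), (A2), (A3) and (A4). Let $g\in\mathcal{I}_P$ be a grayscale image and let $A\subseteq\{0,\pm1,\dots,\pm n\}^k$ be a set of alternating sequences. Then the family $\{X^{\mathcal{E},\mathcal{D}}_{t,\mathbf{u}}\}_{(t,\mathbf{u})}$, indexed by $(t,\mathbf{u})\in\{0,1,\dots,N\}\times A\subseteq\mathbb{Z}^{k+1}$, where $X^{\mathcal{E},\mathcal{D}}_{t,\mathbf{u}}=\big(\tau_t(M^{\mathcal{E},\mathcal{D}}_{\mathbf{u}}(g))\big)^{-1}(0)$, is a $(k+1)$-parameter filtration; that is, $X^{\mathcal{E},\mathcal{D}}_{t,\mathbf{u}}\subseteq X^{\mathcal{E},\mathcal{D}}_{s,\mathbf{v}}$ whenever $t\le s$ and $\mathbf{u}\le\mathbf{v}$.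
   Context: Images: for a set $P\subseteq\mathbb{Z}^m$, an image on $P$ is a function $g:P\to\mathbb{R}_{\ge0}$; $\mathcal{I}_P$ denotes the set of all images on $P$. An image is binary if its range is $\{0,1\}$; otherwise it is called a grayscale image. For $f,g\in\mathcal{I}_P$, write $f\le g$ iff $f(\mathbf{p})\le g(\mathbf{p})$ for all $\mathbf{p}\in P$. Thresholding: for $t\in\mathbb{R}_{\ge0}$, $\tau_t:\mathcal{I}_P\to\mathcal{I}_P$ is defined by $\tau_t(g)(\mathbf{x})=0$ if $g(\mathbf{x})\le t$ and $\tau_t(g)(\mathbf{x})=1$ otherwise. Assumptions on the operations $\mathcal{E}_i,\mathcal{D}_i:\mathcal{I}_P\to\mathcal{I}_P$: for all $f,g\in\mathcal{I}_P$ and all $i,j\in\{0,1,\dots,n\}$, (A1) if $f\le g$, then $\mathcal{E}_i(f)\le\mathcal{E}_i(g)$ and $\mathcal{D}_i(f)\le\mathcal{D}_i(g)$; (A2) if $i\le j$, then $\mathcal{E}_i(g)\ge\mathcal{E}_j(g)$ and $\mathcal{D}_i(g)\le\mathcal{D}_j(g)$; (A3) $\mathcal{D}_0(g)=\mathcal{E}_0(g)=g$; and (A4) for all $i\in\{1,\dots,n\}$ and $t\in\{0,1,\dots,N\}$, $\mathcal{E}_i\circ\tau_t=\tau_t\circ\mathcal{E}_i$ and $\mathcal{D}_i\circ\tau_t=\tau_t\circ\mathcal{D}_i$. For $i\in\{0,\pm1,\dots,\pm n\}$ define $M_i^{\mathcal{E},\mathcal{D}}:\mathcal{I}_P\to\mathcal{I}_P$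 by $M_i^{\mathcal{E},\mathcal{D}}(g)=\mathcal{E}_i(g)$ if $i\ge0$ and $M_i^{\mathcal{E},\mathcal{D}}(g)=\mathcal{D}_{|i|}(g)$ if $i<0$. For $\mathbf{u}=(u_1,\dots,u_k)\in\{0,\pm1,\dots,\pm n\}^k$ define $M^{\mathcal{E},\mathcal{D}}_{\mathbf{u}}=M^{\mathcal{E},\mathcal{D}}_{u_1}\circ M^{\mathcal{E},\mathcal{D}}_{u_2}\circ\cdots\circ M^{\mathcal{E},\mathcal{D}}_{u_k}$. A sequence $\mathbf{i}=(i_1,\dots,i_k)\in\{0,\pm1,\dots,\pm n\}^k$ is alternating if $i_l\cdot i_{l+1}\le0$ for all $l\in\{1,\dots,k-1\}$; a set of alternating sequences is a subset of $\{0,\pm1,\dots,\pm n\}^k$ all of whose elements are alternating. Partial order on $\mathbb{Z}^r$: $\mathbf{u}\le\mathbf{v}$ iff $u_i\le v_i$ for all $i$. A family of sets $\{S_{\mathbf{i}}\}_{\mathbf{i}\in I}$ with $I\subseteq\mathbb{Z}^r$ is an $r$-parameter filtration (multifiltration) if $S_{\mathbf{u}}\subseteq S_{\mathbf{v}}$ whenever $\mathbf{u},\mathbf{v}\in I$ and $\mathbf{u}\le\mathbf{v}$. *)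

(* Defs.v *)
From mathcomp Require Import all_boot all_order all_algebra.
From mathcomp Require Import boolp classical_sets reals interval_inference.

Set Implicit Arguments.
Unset Strict Implicit.
Unset Printing Implicit Defensive.

Import Order.TTheory GRing.Theory Num.Theory.
Local Open Scope classical_set_scope.
Local Open Scope ring_scope.

Definition nat_nng (R : realType) (t : nat) : {nonneg R} := t%:R%:nng.

Definition grid_image (R : realType) (m : nat) (P : set 'rV[int]_m) : Type :=
  P -> {nonneg R}.

Definition image_le (R : realType) (m : nat) (P : set 'rV[int]_m)
    (f g : grid_image R P) : Prop :=
  forall p : P, (f p)%:num <= (g p)%:num.

Definition binary (R : realType) (m : nat) (P : set 'rV[int]_m)
    (g : grid_image R P) : Prop :=
  range g = [set 0%:nng; 1%:nng].

Definition grayscale (R : realType) (m : nat) (P : set 'rV[int]_m)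
    (g : grid_image R P) : Prop :=
  ~ binary g.

Definition threshold (R : realType) (m : nat) (P : set 'rV[int]_m)
    (t : {nonneg R}) (g : grid_image R P) : grid_image R P :=
  fun p => if (g p)%:num <= t%:num then 0%:nng else 1%:nng.

(* Only used for |i| <= n, where [inord `|i|] has value |i|. *)
Definition morph1 (R : realType) (m n : nat) (P : set 'rV[int]_m)
    (E D : 'I_n.+1 -> grid_image R P -> grid_image R P) (i : int) :
    grid_image R P -> grid_image R P :=
  if 0 <= i then E (inord `|i|%N) else D (inord `|i|%N).

(* M_{u_1} \o M_{u_2} \o ... \o M_{u_k}: the last entry of u acts first. *)
Definition morph (R : realType) (m n k : nat) (P : set 'rV[int]_m)
    (E D : 'I_n.+1 -> grid_image R P -> grid_image R P) (u : 'rV[int]_k) :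
    grid_image R P -> grid_image R P :=
  \big[(fun F G => F \o G)/id]_(l < k) morph1 E D (u 0 l).

Definition index_box (n k : nat) : set 'rV[int]_k :=
  [set u : 'rV[int]_k | forall l, (absz (u 0%R l) <= n)%N].

Arguments index_box : clear implicits.

Definition alternating (k : nat) (u : 'rV[int]_k) : Prop :=
  forall l l' : 'I_k, l' = l.+1 :> nat -> u 0 l * u 0 l' <= 0.

Definition vec_le (r : nat) (u v : 'rV[int]_r) : Prop :=
  forall i, u 0 i <= v 0 i.

(* The family is (S u) for u in I; values of S outside I are irrelevant. *)
Definition multifiltration (r : nat) (T : Type) (I : set 'rV[int]_r)
    (S : 'rV[int]_r -> set T) : Prop :=
  forall u v, I u -> I v -> vec_le u v -> S u `<=` S v.

(* {0, ..., N} x A as a subset of Z^(1 + k): the block [lsubmx w] of width 1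
   holds t and [rsubmx w] is u. *)
Definition param_set (N k : nat) (A : set 'rV[int]_k) : set 'rV[int]_(1 + k) :=
  [set w : 'rV[int]_(1 + k) | 0 <= lsubmx w 0 0 <= N%:Z /\ A (rsubmx w)].

Definition zero_set (R : realType) (m n k : nat) (P : set 'rV[int]_m)
    (E D : 'I_n.+1 -> grid_image R P -> grid_image R P) (g : grid_image R P)
    (t : {nonneg R}) (u : 'rV[int]_k) : set P :=
  threshold t (morph E D u g) @^-1` [set 0%:nng].

(* Main.v *)
(* Writing the operations in the order D_n, ..., D_1, id, E_1, ..., E_n, the map
   M_i is pointwise antitone in i in {-n, ..., n}. Since every M_i is also
   monotone in the image, M_u is antitone in u, so M_v g <= M_u g <= t <= s on
   the zero set at (t, u). *)
Require Import Defs.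
From mathcomp Require Import all_boot all_order all_algebra.
From mathcomp Require Import boolp classical_sets reals interval_inference.
From mathcomp Require Import zify.

Set Implicit Arguments.
Unset Strict Implicit.
Unset Printing Implicit Defensive.

Import Order.TTheory GRing.Theory Num.Theory.
Local Open Scope classical_set_scope.
Local Open Scope ring_scope.

Lemma image_le_trans (R : realType) (m : nat) (P : set 'rV[int]_m)
    (f g h : grid_image R P) :
  image_le f g -> image_le g h -> image_le f h.
Proof. by move=> fg gh p; apply: le_trans (fg p) (gh p). Qed.

(** Turns membership in a zero set into a real inequality, so that inclusions of zero sets reduce to
    transitivity of the order. *)
Lemma threshold_eq0 (R : realType) (m : nat) (P : set 'rV[int]_m)
    (t : {nonneg R}) (f : grid_image R P) (p : P) :
  threshold t f p = 0%:nng <-> (f p)%:num <= t%:num.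
Proof.
rewrite /threshold; case: ifP => // _; split=> // /(congr1 (fun x => x%:num)) /=.
by move/eqP; rewrite oner_eq0.
Qed.

Section MorphAntitone.
Variables (R : realType) (m n : nat) (P : set 'rV[int]_m).
Variables E D : 'I_n.+1 -> grid_image R P -> grid_image R P.
Hypothesis ED_mono : forall (f g : grid_image R P) (i : 'I_n.+1),
  image_le f g -> image_le (E i f) (E i g) /\ image_le (D i f) (D i g).
Hypothesis ED_index : forall (g : grid_image R P) (i j : 'I_n.+1),
  (i <= j)%N -> image_le (E j g) (E i g) /\ image_le (D i g) (D j g).
Hypothesis ED0 : forall g : grid_image R P, D ord0 g = g /\ E ord0 g = g.

Lemma morph1_mono (i : int) (f g : grid_image R P) :
  image_le f g -> image_le (morph1 E D i f) (morph1 E D i g).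
Proof. by move=> /ED_mono fg; rewrite /morph1; case: ifP => _; apply fg. Qed.

Lemma morph1_antitone (i j : int) (g : grid_image R P) :
  (`|i| <= n)%N -> (`|j| <= n)%N -> i <= j ->
  image_le (morph1 E D j g) (morph1 E D i g).
Proof.
move=> i_n j_n ij; rewrite /morph1.
have [i_ge0|i_lt0] := leP 0 i; have [j_ge0|j_lt0] := leP 0 j.
(* The bounds by [n] ensure that [inord] keeps the values of the absolute values. *)
- by apply: (proj1 (ED_index _ _)); rewrite !inordK //; lia.
- by lia.
(* Across the sign change, [g] itself separates the two sides: $E_j g \le E_0 g = g = D_0 g \le
   D_{|i|} g$. *)
- apply: (@image_le_trans _ _ _ _ g).
  + by rewrite -[X in image_le _ X](proj2 (ED0 g)); apply: (proj1 (ED_index _ _)).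
  + by rewrite -[X in image_le X _](proj1 (ED0 g)); apply: (proj2 (ED_index _ _)).
(* For negative indices, [i <= j] reverses to $|j| \le |i|$, which matches the growth of [D] in its
   index. *)
- by apply: (proj2 (ED_index _ _)); rewrite !inordK //; lia.
Qed.

Lemma morph_antitone (k : nat) (u v : 'rV[int]_k) (g : grid_image R P) :
  index_box n k u -> index_box n k v -> vec_le u v ->
  image_le (morph E D v g) (morph E D u g).
Proof.
move=> u_box v_box uv.
(* Comparing the two sides at different images makes the relation stable under
   composition. *)
suff: forall f h, image_le f h -> image_le (morph E D v f) (morph E D u h).
  by apply=> p.
rewrite /morph.
apply: (big_ind2 (fun F G : grid_image R P -> grid_image R P =>
  forall f h, image_le f h -> image_le (F f) (G h))) => //=.
- by move=> F1 F2 G1 G2 FF GG f h fh; apply/FF/GG.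
(* One factor changes image first, then index: $M_{v_l} f \le M_{v_l} h \le M_{u_l} h$. *)
- move=> l _ f h fh; apply: (image_le_trans (morph1_mono _ fh)).
  exact: morph1_antitone.
Qed.

End MorphAntitone.

Theorem corollary1 (R : realType) (m k n N : nat)
    (m_gt0 : (0 < m)%N) (k_gt0 : (0 < k)%N) (n_gt0 : (0 < n)%N)
    (P : set 'rV[int]_m)
    (E D : 'I_n.+1 -> grid_image R P -> grid_image R P)
    (A1 : forall (f g : grid_image R P) (i : 'I_n.+1),
      image_le f g -> image_le (E i f) (E i g) /\ image_le (D i f) (D i g))
    (A2 : forall (g : grid_image R P) (i j : 'I_n.+1),
      (i <= j)%N -> image_le (E j g) (E i g) /\ image_le (D i g) (D j g))
    (A3 : forall g : grid_image R P, D ord0 g = g /\ E ord0 g = g)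
    (A4 : forall (i : 'I_n.+1) (t : nat), (0 < i)%N -> (t <= N)%N ->
      E i \o threshold (nat_nng R t) = threshold (nat_nng R t) \o E i /\
      D i \o threshold (nat_nng R t) = threshold (nat_nng R t) \o D i)
    (g : grid_image R P) (g_gray : grayscale g)
    (A : set 'rV[int]_k) (A_box : A `<=` index_box n k)
    (A_alt : forall u, A u -> alternating u) :
  multifiltration (param_set N A)
    (fun w => zero_set E D g (nat_nng R (absz (lsubmx w 0 0))) (rsubmx w)).
Proof.
move=> w w' [w_itv Aw] [w'_itv Aw'] ww' p /threshold_eq0 /= Mw.
apply/threshold_eq0 => /=.
have rww' : vec_le (rsubmx w) (rsubmx w') by move=> l; rewrite !mxE.
apply: (le_trans (morph_antitone A1 A2 A3 g (A_box _ Aw) (A_box _ Aw') rww' p)).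
apply: (le_trans Mw); rewrite ler_nat.
(* Coordinate [lshift k 0] holds the threshold. Both thresholds are nonnegative, so taking absolute
   values preserves their order. *)
have := ww' (lshift k 0); case/andP: w_itv => + _; case/andP: w'_itv => + _.
by rewrite !mxE; lia.
Qed.
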